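(* Let $\sigma>0$ and $\kappa\ge 0$, and for $v\in\mathbb{R}$ let $$\Phi_\kappa(v)=\frac{10^{0.5v/\sigma}}{10^{0.5v/\sigma}+10^{-0.5v/\sigma}+\kappa},\qquad F_\kappa(v)=\frac{10^{0.5v/\sigma}+\frac12\kappa}{10^{0.5v/\sigma}+10^{-0.5v/\sigma}+\kappa}.$$ Consider $M\ge2$ players with rating vector $\theta=(\theta_1,\dots,\theta_M)\in\mathbb{R}^M$ and the three-outcome (home win $\mathsf{H}$, away win $\mathsf{A}$, draw $\mathsf{D}$) model in which, for a game between home player $i_H$ and away player $i_A\ne i_H$ with $v=\theta_{i_H}-\theta_{i_A}$, $$\Pr\{Y=\mathsf{H}\mid\theta\}=\Phi_\kappa(v),\qquad \Pr\{Y=\mathsf{A}\mid\theta\}=\Phi_\kappa(-v),\qquad \Pr\{Y=\mathsf{D}\mid\theta\}=\kappa\sqrt{\Phi_\kappa(v)\Phi_\kappa(-v)}.$$ Then the stochastic gradient algorithm for maximum likelihood estimation of $\theta$ in this model is the $\kappa$-Elo algorithm. That is, for every $K>0$ there is a step $\mu>0$, depending only on $K$ and $\sigma$, such that for every current rating vector $\hat\theta_n\in\mathbb{R}^M$, every pair of distinct players $(i_{H,n},i_{A,n})$ and every outcome $y_n\in\{\mathsf{H},\mathsf{A},\mathsf{D}\}$ (with $y_n\neq\mathsf{D}$ if $\kappa=0$), the stochastic gradient update $$\hat\theta_{n+1}=\hat\theta_n-\mu\,\nabla_\theta L_n(\hat\theta_n),\qquad L_n(\theta)=-\log\Pr\{Y_n=y_n\mid\theta\},$$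 coincides with the update $$\hat\theta_{n+1,i}=\hat\theta_{n,i}+K\big[s_i-F_\kappa(\Delta_i)\big]\quad\text{for } i\in\{i_{H,n},i_{A,n}\},$$ with $\hat\theta_{n+1,m}=\hat\theta_{n,m}$ for all other players $m$.
   Context: $M$ players indexed by $1,\dots,M$ play one-on-one games. At time $n$ the game is between the home player $i_{H,n}$ and the away player $i_{A,n}$, and its outcome is $y_n\in\{\mathsf{H},\mathsf{A},\mathsf{D}\}$ (home win, away win, draw). The vector $\theta=(\theta_1,\dots,\theta_M)$ collects the players' rating levels. Conditioned on $\theta$, outcomes of different games are independent, so the negative log-likelihood of the first $n$ outcomes is $J_n(\theta)=\sum_{l=1}^n L_l(\theta)$ with $L_l(\theta)=-\log\Pr\{Y_l=y_l\mid\theta\}$; the maximum likelihood estimate minimizes $J_n$. The stochastic gradient algorithm with step $\mu>0$ performs, at each time $n$, a single gradient step on the current term $L_n$ only, starting from the current estimate $\hat\theta_n$. In the $\kappa$-Elo update, for a player $i\in\{i_{H,n},i_{A,n}\}$ with opponent $j$ (the other element of $\{i_{H,n},i_{A,n}\}$), $\Delta_i=\hat\theta_{n,i}-\hat\theta_{n,j}$, and the score is $s_i=1$ if player $i$ won the game, $s_i=0$ if player $i$ lost it, and $s_i=\frac12$ if it was a draw. $\hat\theta_{n,m}$ denotes the $m$-th component of $\hat\theta_n$. *)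

(* Defs.v *)
From HB Require Import structures.
From mathcomp Require Import all_boot all_order all_algebra.
From mathcomp Require Import all_classical all_reals all_analysis.

Set Implicit Arguments.
Unset Strict Implicit.
Unset Printing Implicit Defensive.

Import Order.TTheory GRing.Theory Num.Theory.
Import numFieldNormedType.Exports.

Local Open Scope ring_scope.

Inductive outcome := HomeWin | AwayWin | Draw.

Section KappaElo.
Variable R : realType.

Definition Phi (sigma kappa v : R) : R :=
  10 `^ (2^-1 * v / sigma)
  / (10 `^ (2^-1 * v / sigma) + 10 `^ (- (2^-1 * v / sigma)) + kappa).

Definition F (sigma kappa v : R) : R :=
  (10 `^ (2^-1 * v / sigma) + 2^-1 * kappa)
  / (10 `^ (2^-1 * v / sigma) + 10 `^ (- (2^-1 * v / sigma)) + kappa).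

Section Players.
Variable M : nat.
Implicit Types (iH iA i : 'I_M) (y : outcome) (theta : 'rV[R]_M).

Definition outcome_prob (sigma kappa : R) iH iA y theta : R :=
  let v := theta 0 iH - theta 0 iA in
  match y with
  | HomeWin => Phi sigma kappa v
  | AwayWin => Phi sigma kappa (- v)
  | Draw => kappa * Num.sqrt (Phi sigma kappa v * Phi sigma kappa (- v))
  end.

Definition neg_log_lik (sigma kappa : R) iH iA y theta : R :=
  - ln (outcome_prob sigma kappa iH iA y theta).

(* Total, like the directional derivative ['D_v f x]: it is the gradient
   only at points where [f] is differentiable. *)
Definition gradient (f : 'rV[R]_M -> R) theta : 'rV[R]_M :=
  \row_m 'D_(delta_mx 0 m) f theta.

Definition sg_update (mu : R) (L : 'rV[R]_M -> R) theta : 'rV[R]_M :=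
  theta - mu *: gradient L theta.

(* [opponent] and [score] are meaningful only for [i] equal to [iH] or [iA]. *)
Definition opponent iH iA i : 'I_M := if i == iH then iA else iH.

Definition score iH y i : R :=
  match y with
  | HomeWin => if i == iH then 1 else 0
  | AwayWin => if i == iH then 0 else 1
  | Draw => 2^-1
  end.

Definition kappa_elo_update (sigma kappa K : R) iH iA y theta : 'rV[R]_M :=
  \row_i if (i == iH) || (i == iA) then
    theta 0 i + K * (score iH y i
      - F sigma kappa (theta 0 i - theta 0 (opponent iH iA i)))
  else theta 0 i.

End Players.
End KappaElo.

(* Main.v *)
Require Import Defs.
From HB Require Import structures.
From mathcomp Require Import all_boot all_order all_algebra.
From mathcomp Require Import all_classical all_reals all_analysis.
From mathcomp Require Import ring.

Set Implicit Arguments.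
Unset Strict Implicit.
Unset Printing Implicit Defensive.

Import Order.TTheory GRing.Theory Num.Theory.
Import numFieldNormedType.Exports.

Local Open Scope ring_scope.

(* With c = ln 10 / (2 sigma) and D(v) = e^(cv) + e^(-cv) + kappa, every outcome
   has negative log-likelihood ln D(v) - (2 s - 1) c v + const, where s is the
   home player's score (for a draw, because Phi(v) Phi(-v) = D(v)^-2).  Since
   (ln D)' = c (2 F - 1), its derivative in v is 2 c (F(v) - s), so the step
   mu = K / (2 c) turns a gradient step into the Elo step for the home player;
   F(-v) = 1 - F(v) gives the away player's step. *)

Section Rating.
Variables (R : realType) (sigma kappa : R).
Hypotheses (sigma_gt0 : 0 < sigma) (kappa_ge0 : 0 <= kappa).

Definition elo_rate : R := ln 10 / (2 * sigma).

Definition elo_norm (v : R) : R :=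
  expR (elo_rate * v) + expR (- (elo_rate * v)) + kappa.

Lemma elo_rate_gt0 : 0 < elo_rate.
Proof. by rewrite divr_gt0 ?mulr_gt0// ln_gt0// ltr1n. Qed.

Lemma elo_norm_gt0 v : 0 < elo_norm v.
Proof. by rewrite ltr_wpDr// addr_gt0// expR_gt0. Qed.

Lemma elo_normN v : elo_norm (- v) = elo_norm v.
Proof. by rewrite /elo_norm mulrN opprK [X in X + _]addrC. Qed.

Lemma powR10E v : 10 `^ (2^-1 * v / sigma) = expR (elo_rate * v).
Proof.
rewrite /powR pnatr_eq0/=; congr expR; rewrite /elo_rate.
by field; rewrite gt_eqF.
Qed.

Lemma powR10NE v : 10 `^ (- (2^-1 * v / sigma)) = expR (- (elo_rate * v)).
Proof. by rewrite powRN powR10E expRN. Qed.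

Lemma PhiE v : Phi sigma kappa v = expR (elo_rate * v) / elo_norm v.
Proof. by rewrite /Phi powR10E powR10NE. Qed.

Lemma FE v : F sigma kappa v = (expR (elo_rate * v) + 2^-1 * kappa) / elo_norm v.
Proof. by rewrite /F powR10E powR10NE. Qed.

(** The numerators at [v] and [- v] add up to the common denominator [elo_norm v], each supplying
    half of [kappa]. *)
Lemma FN v : F sigma kappa (- v) = 1 - F sigma kappa v.
Proof.
rewrite !FE elo_normN mulrN; have := elo_norm_gt0 v; rewrite /elo_norm => D0.
by field; rewrite gt_eqF.
Qed.

Lemma ln_Phi v : ln (Phi sigma kappa v) = elo_rate * v - ln (elo_norm v).
Proof.
by rewrite PhiE ln_div ?posrE ?expR_gt0 ?elo_norm_gt0// expRK.
Qed.

Lemma sqrt_PhiM v :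
  Num.sqrt (Phi sigma kappa v * Phi sigma kappa (- v)) = (elo_norm v)^-1.
Proof.
rewrite !PhiE elo_normN mulrACA mulrN -expRD subrr expR0 mul1r -expr2.
by rewrite sqrtr_sqr ger0_norm// invr_ge0 ltW// elo_norm_gt0.
Qed.

Lemma is_derive_elo_norm (v : R) : is_derive v 1 elo_norm
  (elo_rate * (expR (elo_rate * v) - expR (- (elo_rate * v)))).
Proof.
have dl : is_derive v 1 ( *%R elo_rate) elo_rate.
  by apply: is_derive_eq; rewrite /GRing.scale /=; ring.
have dN : is_derive v 1 (fun x : R => - (elo_rate * x)) (- elo_rate).
  exact: (is_deriveN dl).
(* The point-free form lets instance resolution assemble the derivative, using [dl] and [dN] for the
   inner functions. *)
have -> : elo_norm = (expR \o *%R elo_rate)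
    + (expR \o (fun x => - (elo_rate * x))) + cst kappa.
  by apply/funext.
by apply: is_derive_eq; ring.
Qed.

(** With c = [elo_rate], this is e^(cv) - e^(-cv) = 2 (e^(cv) + kappa/2) - [elo_norm v], divided by
    [elo_norm v]. *)
Lemma is_derive_ln_elo_norm (v : R) :
  is_derive v 1 (@ln R \o elo_norm) (elo_rate * (2 * F sigma kappa v - 1)).
Proof.
have D0 := elo_norm_gt0 v.
have dN := is_derive_elo_norm v.
have dln := is_derive1_ln D0.
apply: is_derive_eq.
rewrite FE; move: D0; rewrite /elo_norm => D0.
by field; rewrite gt_eqF.
Qed.

(** One function of the rating gap for all three outcomes: [s] is the home score, so 2s - 1 is 1, -1
    or 0, and [b] absorbs the constant [ln kappa] of a draw. *)
Definition game_loss (s b v : R) : R :=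
  ln (elo_norm v) - (2 * s - 1) * elo_rate * v - b.

Lemma is_derive_game_loss (s b v : R) :
  is_derive v 1 (game_loss s b) (2 * elo_rate * (F sigma kappa v - s)).
Proof.
have dD := is_derive_ln_elo_norm v.
have -> : game_loss s b =
    (@ln R \o elo_norm) - ((2 * s - 1) * elo_rate) *: id - cst b.
  by apply/funext.
by apply: is_derive_eq; rewrite /GRing.scale /=; ring.
Qed.

Section Game.
Variables (M : nat) (iH iA : 'I_M) (y : outcome).
Hypotheses (iHA : iH <> iA) (kappa_draw : kappa = 0 -> y <> Draw).

Let gap (theta : 'rV[R]_M) : R := theta 0 iH - theta 0 iA.

Lemma neg_log_likE :
  neg_log_lik sigma kappa iH iA y =
  game_loss (score R iH y iH) (if y is Draw then ln kappa else 0) \o gap.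
Proof.
apply/funext => theta; rewrite /neg_log_lik /outcome_prob /=.
rewrite /game_loss /score eqxx -/(gap theta); case: y kappa_draw => kD.
- by rewrite ln_Phi; ring.
- by rewrite ln_Phi elo_normN; ring.
(* Splitting the logarithm of the draw probability into [ln kappa] and [- ln (elo_norm _)] requires
   [kappa] to be positive. *)
- have k0 : 0 < kappa by rewrite lt_neqAle kappa_ge0 andbT eq_sym; apply/eqP => /kD.
  rewrite sqrt_PhiM lnM ?posrE ?invr_gt0 ?elo_norm_gt0//.
  by rewrite lnV ?posrE ?elo_norm_gt0//; field.
Qed.

Let differentiable_gap theta : differentiable gap theta.
Proof.
have -> : gap = (fun t : 'rV_M => t 0 iH : R) - (fun t : 'rV_M => t 0 iA : R).
  exact/funext.
by apply: differentiableB; exact: differentiable_coord.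
Qed.

Let derive_gap theta w : 'D_w gap theta = gap w.
Proof.
have gap_linear : linear gap.
  by move=> a u v; rewrite /gap !mxE /GRing.scale /=; ring.
(* A continuous linear map is its own differential; [gap] is packed as a linear map so that
   [diff_lin] applies. *)
pose gapM := GRing.isLinear.Build _ _ _ _ _ gap_linear.
pose gapL : {linear _ -> _} := HB.pack gap gapM.
rewrite deriveE// -[gap]/(gapL : _ -> _) diff_lin// => t.
exact: differentiable_continuous.
Qed.

(** This ensures that the row of partial derivatives in [gradient] is a genuine gradient. *)
Lemma differentiable_neg_log_lik theta :
  differentiable (neg_log_lik sigma kappa iH iA y) theta.
Proof.
rewrite neg_log_likE; apply: differentiable_comp => //.
by apply/derivable1_diffP; have [] := is_derive_game_loss
  (score R iH y iH) (if y is Draw then ln kappa else 0) (gap theta).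
Qed.

(** Chain rule through [gap]. For a basis vector [w], the first factor is 1 at the home player, -1
    at the away player and 0 elsewhere. *)
Lemma derive_neg_log_lik theta w :
  'D_w (neg_log_lik sigma kappa iH iA y) theta
  = (w 0 iH - w 0 iA) *
    (2 * elo_rate * (F sigma kappa (theta 0 iH - theta 0 iA) - score R iH y iH)).
Proof.
rewrite deriveE; last exact: differentiable_neg_log_lik.
rewrite neg_log_likE; set f := game_loss _ _.
have [df f'E] := is_derive_game_loss
  (score R iH y iH) (if y is Draw then ln kappa else 0) (gap theta).
have {}df : differentiable f (gap theta) by apply/derivable1_diffP.
by rewrite diff_comp//= diff1E// derive1E f'E -deriveE// derive_gap.
Qed.

Lemma scoreN : score R iH y iA = 1 - score R iH y iH.
Proof.
have /negbTE iAH : iA != iH by apply/eqP => /esym.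
by rewrite /score iAH eqxx; case: y; field.
Qed.

Lemma sg_update_kappa_elo K theta :
  sg_update (K / (2 * elo_rate)) (neg_log_lik sigma kappa iH iA y) theta
  = kappa_elo_update sigma kappa K iH iA y theta.
Proof.
have c0 : elo_rate != 0 by rewrite gt_eqF// elo_rate_gt0.
have /negbTE iAH : iA != iH by apply/eqP => /esym.
apply/rowP => i; rewrite !mxE derive_neg_log_lik !mxE !eqxx /=.
rewrite [iH == i]eq_sym [iA == i]eq_sym /opponent.
have [->|iiH] := eqVneq i iH.
  by rewrite [iH == iA]eq_sym iAH /=; field.
have [->|iiA] /= := eqVneq i iA; last by rewrite subrr mul0r mulr0 subr0.
(* The away player sees the opposite gap: (1 - s) - (1 - F(v)) = F(v) - s, matching the sign -1 of
   this gradient component. *)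
by rewrite -[theta 0 iA - _]opprB FN scoreN; field.
Qed.

End Game.
End Rating.

Theorem mainTheorem2 (R : realType) (sigma : R) (sigma_gt0 : 0 < sigma)
    (K : R) (K_gt0 : 0 < K) :
  exists mu : R, 0 < mu /\
    forall (kappa : R) (M : nat), 0 <= kappa -> (2 <= M)%N ->
    forall (theta : 'rV[R]_M) (iH iA : 'I_M) (y : outcome),
      iH <> iA -> (kappa = 0 -> y <> Draw) ->
      differentiable (neg_log_lik sigma kappa iH iA y) theta /\
      sg_update mu (neg_log_lik sigma kappa iH iA y) theta
        = kappa_elo_update sigma kappa K iH iA y theta.
Proof.
(* [elo_rate] involves [sigma] alone, so the step can be fixed before [kappa], [M] and the game. *)
exists (K / (2 * elo_rate sigma)); split.
  by rewrite divr_gt0// mulr_gt0// elo_rate_gt0.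
move=> kappa M kappa_ge0 _ theta iH iA y iHA kappa_draw; split.
  exact: differentiable_neg_log_lik.
exact: sg_update_kappa_elo.
Qed.
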